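(* Let $G$ be a connected graph, $n$ a positive integer, and $t$ a positive integer threshold, and let $d=dyn_t(G)$. Then $dyn_t(G\Box K_n)\le td-\left(\dfrac{t^2-3t}{2}+d\right)$.
   Context: $K_n$ is the complete graph on $n$ vertices; $G\Box H$ is the Cartesian product (vertex set $V(G)\times V(H)$, $(u,v)\sim(u',v')$ iff $u=u'$ and $vv'\in E(H)$, or $v=v'$ and $uu'\in E(G)$). Thresholds are assumed not to exceed vertex degrees. For constant threshold $t$, a set $D$ of vertices is a $t$-dynamic monopoly if starting from $D$ and repeatedly adding any vertex having at least $t$ neighbors in the current set eventually yields all vertices; $dyn_t(G)$ is the minimum size of a $t$-dynamic monopoly. *)

(* Defs.v *)
From mathcomp Require Import all_boot all_order all_algebra.

Set Implicit Arguments.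
Unset Strict Implicit.
Unset Printing Implicit Defensive.

Record sgraph := SGraph {
  vert :> finType;
  adj : rel vert;
  adj_sym : symmetric adj;
  adj_irr : irreflexive adj
}.

Definition nbrs (G : sgraph) (v : G) : {set G} := [set u | adj v u].

Definition deg (G : sgraph) (v : G) : nat := #|nbrs v|.

(* The empty graph is not connected. *)
Definition connected_graph (G : sgraph) : Prop :=
  0 < #|G| /\ forall u v : G, connect (@adj G) u v.

Section Complete.
Variable n : nat.

Definition complete_adj : rel 'I_n := fun i j => i != j.

Fact complete_adj_sym : symmetric complete_adj.
Proof. by move=> i j; rewrite /complete_adj eq_sym. Qed.

Fact complete_adj_irr : irreflexive complete_adj.
Proof. by move=> i; rewrite /complete_adj eqxx. Qed.

Definition complete : sgraph := SGraph complete_adj_sym complete_adj_irr.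

End Complete.

Section CartesianProduct.
Variables G H : sgraph.

Definition cart_adj : rel (G * H) := fun x y =>
  ((x.1 == y.1) && adj x.2 y.2) || ((x.2 == y.2) && adj x.1 y.1).

Fact cart_adj_sym : symmetric cart_adj.
Proof.
move=> x y; rewrite /cart_adj (eq_sym x.1) (eq_sym x.2).
by rewrite (adj_sym x.1) (adj_sym x.2).
Qed.

Fact cart_adj_irr : irreflexive cart_adj.
Proof. by move=> x; rewrite /cart_adj !adj_irr !andbF. Qed.

Definition cart_prod : sgraph := SGraph cart_adj_sym cart_adj_irr.

End CartesianProduct.

Notation "G □ H" := (cart_prod G H) (at level 40, left associativity).
Notation "''K_' n" := (complete n) (at level 8, n at level 2, format "''K_' n").

Section DynamicMonopoly.
Variables (t : nat) (G : sgraph).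

Definition activation_step : rel {set G} := fun A B =>
  [exists v : G, (t <= #|nbrs v :&: A|) && (B == v |: A)].

(* Activation is monotone in the current set, so reaching all vertices along some
   order of additions is the same as every maximal order ending at all vertices. *)
Definition dynamic_monopoly (D : {set G}) : bool :=
  connect activation_step D [set: G].

Fact dynamic_monopolyT : dynamic_monopoly [set: G].
Proof. exact: connect0. Qed.

Definition dyn : nat := #|[arg min_(D < [set: G] | dynamic_monopoly D) #|D| ]|.

Fact dyn_min (D : {set G}) : dynamic_monopoly D -> dyn <= #|D|.
Proof.
by rewrite /dyn; case: arg_minnP => [|A _ minA]; [exact: dynamic_monopolyT | exact: minA].
Qed.

End DynamicMonopoly.

(* Main.v *)
Require Import Defs.
From mathcomp Require Import all_boot all_order all_algebra.
From mathcomp Require Import zify lra.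

(** Write [e s] for [dyn s G].  Seed the [i]-th copy of [G] in [G □ 'K_n]
    (counting from 0) with a minimum [(t - i)]-dynamic monopoly: once the copies
    below it are full, each of its vertices already has [i] active neighbours, so
    the copies fill up one after the other.  Removing any vertex from an
    [s.+1]-dynamic monopoly leaves an [s]-dynamic monopoly when the degrees are at
    least [s], whence [e s < e s.+1]; together with [e 0 = 0] and [e 1 <= 1] this
    bounds the number of seeds by [d + (d - 1) + ... + (d - t + 2) + 1]. *)

Set Implicit Arguments.
Unset Strict Implicit.
Unset Printing Implicit Defensive.

Section ClosedSets.
Variables (t : nat) (G : sgraph).
Implicit Types (A B C D : {set G}) (v : G).

Definition activation_closed C : Prop :=
  forall v, t <= #|nbrs v :&: C| -> v \in C.

Lemma connect_activation_sub A B C :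
    activation_closed C -> A \subset C ->
  connect (@activation_step t G) A B -> B \subset C.
Proof.
move=> clC + /connectP[p + ->]; elim: p A => //= B' p IHp A sAC /andP[+ pB'].
move=> /existsP[v /andP[tv /eqP defB']]; apply: IHp pB'.
rewrite defB' subUset sAC sub1set andbT; apply: clC.
exact/(leq_trans tv)/subset_leq_card/setIS.
Qed.

(** Activation never leaves a closed set, and a reachable set of maximum cardinality is closed. This
    removes the order of activations from all later arguments. *)
Lemma dynamic_monopolyP D :
  dynamic_monopoly t D <->
  (forall C, activation_closed C -> D \subset C -> C = [set: G]).
Proof.
split=> [dynD C clC sDC | closedT].
  by apply/eqP; rewrite -subTset; apply: connect_activation_sub dynD.
pose reach A := (D \subset A) && connect (@activation_step t G) D A.
have reachD : reach D by rewrite /reach subxx connect0.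
have [A /andP[sDA DA] maxA] := arg_maxnP (fun A => #|A|) reachD.
rewrite /dynamic_monopoly -(closedT A) // => v tv; apply: contraLR isT => nAv.
have /maxA : reach (v |: A).
  rewrite /reach (subset_trans sDA (subsetUr _ _)) (connect_trans DA) //.
  by apply/connect1/existsP; exists v; rewrite tv eqxx.
by rewrite cardsU1 nAv add1n /= ltnn.
Qed.

Lemma dyn_attained : exists2 D : {set G}, dynamic_monopoly t D & #|D| = dyn t G.
Proof.
by rewrite /dyn; case: arg_minnP => [|A dynA _];
  [exact: dynamic_monopolyT | exists A].
Qed.

End ClosedSets.

Section DynThreshold.
Variable G : sgraph.

Lemma dyn0 : dyn 0 G = 0.
Proof.
apply/eqP; rewrite -leqn0 -[leqRHS](cards0 G); apply: dyn_min.
by apply/dynamic_monopolyP=> C clC _; apply/setP=> v; rewrite inE clC.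
Qed.

Lemma dyn1_le1 : connected_graph G -> dyn 1 G <= 1.
Proof.
case=> /card_gt0P[x _] connG; rewrite -[leqRHS](cards1 x); apply: dyn_min.
apply/dynamic_monopolyP=> C clC; rewrite sub1set => Cx.
apply/setP=> y; rewrite inE; have /connectP[p + ->] := connG x y.
elim: p x Cx => //= z p IHp x Cx /andP[xz]; apply: IHp.
by apply: clC; apply/card_gt0P; exists x; rewrite !inE adj_sym xz.
Qed.

(** If [C] is [s]-closed and contains [D :\ x], then [x |: C] is [s.+1]-closed, because [x] adds at
    most one active neighbour to any vertex. So [C] misses at most [x], whose neighbours, at least
    [s] of them, then all lie in [C]. *)
Lemma dynamic_monopolyD1 s (D : {set G}) x :
    (forall v : G, s <= deg v) ->
  dynamic_monopoly s.+1 D -> dynamic_monopoly s (D :\ x).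
Proof.
move=> degG /dynamic_monopolyP closedT; apply/dynamic_monopolyP=> C clC sDC.
have xCT : x |: C = [set: G].
  apply: closedT; last by rewrite -subDset.
  move=> v sv; rewrite setU1r // clC // -ltnS (leq_trans sv) //.
  rewrite setIUr (leq_trans (leq_card_setU _ _)) // -add1n leq_add2r.
  by rewrite -(cards1 x) subset_leq_card // subsetIr.
have nCx v : v != x -> v \in C.
  by move=> nvx; have := in_setT v; rewrite -xCT !inE (negPf nvx).
apply/setP=> v; rewrite inE; have [->|/nCx //] := eqVneq v x.
apply: clC; rewrite (leq_trans (degG x)) // subset_leq_card //.
apply/subsetP=> u xu; rewrite inE xu nCx //; apply: contraTneq xu => ->.
by rewrite inE adj_irr.
Qed.

Lemma dyn_ltS s :
  0 < #|G| -> (forall v : G, s <= deg v) -> dyn s G < dyn s.+1 G.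
Proof.
move=> /card_gt0P[y _] degG; have [D dynD <-] := dyn_attained s.+1 G.
have [D0|[x Dx]] := set_0Vmem D; last first.
  by rewrite (cardsD1 x) Dx add1n ltnS dyn_min // dynamic_monopolyD1.
(* The empty set is closed for a positive threshold, so it cannot be a monopoly of a nonempty
   graph. *)
have /dynamic_monopolyP/(_ set0) := dynD; rewrite D0 subxx => set0T.
have /setP/(_ y) : set0 = [set: G].
  by apply: set0T => // v; rewrite setI0 cards0.
by rewrite !inE.
Qed.

End DynThreshold.

Section ProductWithComplete.
Variables (G : sgraph) (n t : nat).

Lemma dynamic_monopoly_layers (S : 'I_n -> {set G}) :
    (forall i : 'I_n, dynamic_monopoly (t - i) (S i)) ->
  dynamic_monopoly t ([set x | x.1 \in S x.2] : {set G □ 'K_n}).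
Proof.
move=> dynS; apply/dynamic_monopolyP=> C clC sSC.
suff layerT k (i : 'I_n) : i < k -> forall v, (v, i) \in C.
  by apply/setP=> -[v i]; rewrite (layerT i.+1) // inE.
elim: k i => // k IHk i; rewrite ltnS => le_ik.
pose Ci := [set v | (v, i) \in C].
suff /setP CiT : Ci = [set: G] by move=> v; have := CiT v; rewrite !inE.
have /dynamic_monopolyP := dynS i; apply; last first.
  by apply/subsetP=> v Sv; rewrite inE (subsetP sSC) // inE.
move=> v tv; rewrite inE; apply: clC.
(* Active neighbours of [(v, i)] come from two disjoint sources: [A] in its own copy, of size at
   least [t - i], and [B], the [i] copies of [v] in the full layers below. *)
pose Lo := [set j : 'I_n | j < i].
have cardLo : #|Lo| = i.
  rewrite -sum1dep_card -(big_ord_widen n (fun=> 1)) ?(ltnW (ltn_ord i)) //.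
  by rewrite sum1_card card_ord.
pose A := [set ((u, i) : G □ 'K_n) | u in nbrs v :&: Ci].
pose B := [set ((v, j) : G □ 'K_n) | j in Lo].
have cardA : #|A| = #|nbrs v :&: Ci| by apply: card_imset => u w [].
have cardB : #|B| = i by rewrite card_imset // => j l [].
have disjAB : [disjoint A & B].
  apply/pred0P=> x; apply/negP=> /andP[/imsetP[u _ ->] /imsetP[j + [_ ij]]].
  by rewrite -ij inE ltnn.
have le_t : t <= #|A :|: B|.
  by rewrite cardsU disjoint_setI0 // cards0 subn0 cardA cardB addnC -leq_subLR.
rewrite (leq_trans le_t) // subset_leq_card // subUset; apply/andP; split.
  apply/subsetP=> _ /imsetP[u + ->]; rewrite !inE => /andP[vu Cu].
  by rewrite Cu andbT /= /cart_adj /= eqxx vu orbT.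
apply/subsetP=> _ /imsetP[j + ->]; rewrite !inE => ltji.
rewrite IHk ?(leq_trans ltji) // andbT /= /cart_adj /= eqxx.
by rewrite /complete_adj neq_ltn ltji orbT.
Qed.

Lemma dyn_prod_complete_le : dyn t (G □ 'K_n) <= \sum_(i < n) dyn (t - i) G.
Proof.
have /fin_all_exists2[S dynS cardS] (i : 'I_n) := dyn_attained (t - i) G.
apply: leq_trans (dyn_min (dynamic_monopoly_layers dynS)) _.
under eq_bigr => i _ do rewrite -cardS -sum1_card.
rewrite pair_big_dep /= -sum1_card.
rewrite (reindex (fun x : 'I_n * G => (x.2, x.1))) /=; last first.
  by exists (fun x => (x.2, x.1)) => -[].
by apply/eq_leq/eq_bigl => x; rewrite inE.
Qed.

End ProductWithComplete.

(** Subtraction is truncated, so the indices [i >= t] contribute [e 0 = 0]; the others give distinct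
    terms of the right-hand sum, from the last one down. *)
Lemma sum_subn_le (e : nat -> nat) n t :
  e 0 = 0 -> \sum_(i < n) e (t - i) <= \sum_(k < t) e k.+1.
Proof.
move=> e0; elim: t n => [|t IHt] [|n]; rewrite ?big_ord0 //.
  by rewrite big1 // => i _; rewrite sub0n.
by rewrite big_ord_recl big_ord_recr /= addnC leq_add2r IHt.
Qed.

(** Going down from [e m.+1], each value loses at least 1, and the last one, [e 1], is bounded by 1
    instead. Doubling and moving the square to the left avoid division and subtraction. *)
Lemma sum_slope1_le (e : nat -> nat) m :
    e 1 <= 1 -> (forall k, k < m -> e k.+1 < e k.+2) ->
  2 * (\sum_(k < m.+1) e k.+1) + m.+1 ^ 2 <= 2 * (m * e m.+1) + 3 * m.+1.
Proof.
move=> e1; elim: m => [|m IHm] lt_e; first by rewrite big_ord1 /=; lia.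
have /IHm{}IHm k : k < m -> e k.+1 < e k.+2 by move=> km; rewrite lt_e // ltnW.
(* The change of the coefficient's partner from [e m.+1] to [e m.+2] is a nonlinear comparison,
   supplied here for [lia]. *)
have := leq_mul (leqnn m) (lt_e m (leqnn _)).
rewrite big_ord_recr /=; move: IHm; move: (\sum_(_ < _) _) (e m.+1) (e m.+2) => T E E'.
lia.
Qed.

Import Order.TTheory GRing.Theory Num.Theory.
Local Open Scope ring_scope.

Theorem theorem10 (G : sgraph) (n t d : nat)
    (hG : connected_graph G) (hn : (0 < n)%N) (ht : (0 < t)%N)
    (hdeg : forall v : G, (t <= deg v)%N)
    (hd : d = dyn t G) :
  (dyn t (G □ 'K_n))%:R <=
    t%:R * d%:R - ((t%:R ^+ 2 - 3 * t%:R) / 2 + d%:R) :> rat.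
Proof.
case: t ht hdeg hd => // m _ hdeg ->.
have le_sum := leq_trans (dyn_prod_complete_le G n m.+1)
  (@sum_subn_le (fun s => dyn s G) n m.+1 (dyn0 G)).
have slope k : (k < m)%N -> (dyn k.+1 G < dyn k.+2 G)%N.
  move=> km; apply: dyn_ltS => [|v]; first by case: hG.
  by rewrite (leq_trans _ (hdeg v)) // ltnS ltnW.
have bound := @sum_slope1_le (fun s => dyn s G) m (dyn1_le1 hG) slope.
(* With [t = m.+1], [t * d - d] is [m * d], so this is twice the goal without subtraction. *)
have : (2 * dyn m.+1 (G □ 'K_n) + m.+1 ^ 2
        <= 2 * (m * dyn m.+1 G) + 3 * m.+1)%N by lia.
rewrite -(ler_nat rat) !natrD !natrM -(natr1 m); lra.
Qed.
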